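(* Let $n,k$ be positive integers with $n\geq 3$ and $k<\frac{n}{2}$, let $q$ be a power of a prime, and let $G=S(q,n,k)$. If $n\neq 2k+1$, then $\mathrm{Aut}(G)\cong P\Gamma L_n(\mathbb{F}_q)$. If $n=2k+1$, then $\mathrm{Aut}(G)\cong P\Gamma L_n(\mathbb{F}_q)\rtimes \mathbb{Z}_2$.
   Context: Let $V(q,n)$ be a vector space of dimension $n$ over the finite field $\mathbb{F}_q$ of order $q$, and let $V_k$ and $V_{k+1}$ be the sets of subspaces of $V(q,n)$ of dimensions $k$ and $k+1$, respectively. The graph $S(q,n,k)$ has vertex-set $V_k\cup V_{k+1}$, and two vertices $v$ and $w$ are adjacent whenever (they are distinct and) $v$ is a subspace of $w$ or $w$ is a subspace of $v$. For a field $K$, $\Gamma L_n(K)$ is the group of semilinear automorphisms of an $n$-dimensional vector space $V(n)$ over $K$, i.e. bijections $f:V(n)\to V(n)$ for which there is a field automorphism $\tau$ of $K$ with $f(c_1v_1+c_2v_2)=\tau(c_1)f(v_1)+\tau(c_2)f(v_2)$ for all $c_1,c_2\in K$, $v_1,v_2\in V(n)$. $P\Gamma L_n(K)$ is the quotient of $\Gamma L_n(K)$ by the normal subgroup of nonzero scalar maps. $\mathrm{Aut}(X)$ is the automorphism group of the graph $X$, and $\mathbb{Z}_2$ is the cyclic group of order 2. $\Gamma\cong N\rtimes Q$ means that $\Gamma$ has a normal subgroup $N'\cong N$ and a subgroup $Q'\cong Q$ with $N'Q'=\Gamma$ and $N'\cap Q'=1$. *)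

(* Defs.v *)
From HB Require Import structures.
From mathcomp Require Import all_boot all_order all_fingroup all_algebra.
From mathcomp Require Import all_solvable.

Set Implicit Arguments.
Unset Strict Implicit.
Unset Printing Implicit Defensive.

Import GroupScope GRing.Theory.
Local Open Scope ring_scope.

(* The library has no finType instance on the subspaces of a finite space. *)
Lemma vspace_setK (F : finFieldType) (n : nat) :
  cancel (fun U : {vspace 'rV[F]_n} => [set v in U])
         (fun A : {set 'rV[F]_n} => <<enum A>>%VS).
Proof.
move=> U; apply/eqP; rewrite eqEsubv; apply/andP; split.
  by apply/span_subvP=> v; rewrite mem_enum inE.
by apply/subvP=> v Uv; apply: memv_span; rewrite mem_enum inE.
Qed.

HB.instance Definition _ (F : finFieldType) (n : nat) :=
  Choice_isCountable.Build {vspace 'rV[F]_n}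
    (pcan_pickleK (can_pcan (@vspace_setK F n))).
HB.instance Definition _ (F : finFieldType) (n : nat) :=
  isFinite.Build {vspace 'rV[F]_n} (pcan_enumP (can_pcan (@vspace_setK F n))).

Section GraphAutomorphisms.

Variables (T : finType) (e : rel T).

Definition graph_aut : {set {perm T}} :=
  [set s : {perm T} | [forall x, forall y, e (s x) (s y) == e x y]].

Lemma graph_autP (s : {perm T}) :
  reflect (forall x y, e (s x) (s y) = e x y) (s \in graph_aut).
Proof.
rewrite inE; apply: (iffP forallP) => [h x y|h x].
  exact/eqP/(forallP (h x)).
by apply/forallP => y; rewrite h.
Qed.

Lemma graph_aut_group_set : group_set graph_aut.
Proof.
apply/group_setP; split=> [|s t /graph_autP hs /graph_autP ht].
  by apply/graph_autP => x y; rewrite !perm1.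
by apply/graph_autP => x y; rewrite !permM ht hs.
Qed.

Canonical graph_aut_group := Group graph_aut_group_set.

End GraphAutomorphisms.

Section SubspaceGraph.

Variables (F : finFieldType) (n k : nat).

Definition S_vertex : finType :=
  {U : {vspace 'rV[F]_n} | (\dim U == k) || (\dim U == k.+1)}.

Definition S_adj : rel S_vertex := fun v w =>
  (v != w) && ((val v <= val w)%VS || (val w <= val v)%VS).

Lemma S_adj_sym : symmetric S_adj.
Proof. by move=> v w; rewrite /S_adj eq_sym orbC. Qed.

Lemma S_adj_irr : irreflexive S_adj.
Proof. by move=> v; rewrite /S_adj eqxx. Qed.

End SubspaceGraph.

Section SemilinearGroup.

Variables (F : finFieldType) (n : nat).

Definition field_aut : {set {perm F}} :=
  [set tau : {perm F} | (tau 1 == 1) && [forall a, forall b,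
     (tau (a + b) == tau a + tau b) && (tau (a * b) == tau a * tau b)]].

Definition semilinear (tau : {perm F}) (f : {perm 'rV[F]_n}) : bool :=
  [forall c1, forall c2, forall v1, forall v2,
     f (c1 *: v1 + c2 *: v2) == tau c1 *: f v1 + tau c2 *: f v2].

Definition GammaL : {set {perm 'rV[F]_n}} :=
  [set f | [exists tau in field_aut, semilinear tau f]].

Definition scalar_maps : {set {perm 'rV[F]_n}} :=
  [set f : {perm 'rV[F]_n} |
     [exists c : F, (c != 0) && [forall v, f v == c *: v]]].

Lemma field_autP (tau : {perm F}) :
  reflect [/\ tau 1 = 1, {morph tau : a b / a + b} & {morph tau : a b / a * b}]
          (tau \in field_aut).
Proof.
rewrite inE; apply: (iffP andP) => [[/eqP t1 /forallP h]|[t1 tD tM]].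
  by split=> // a b; have /forallP/(_ b)/andP[/eqP ? /eqP ?] := h a.
split; first exact/eqP.
by apply/forallP=> a; apply/forallP=> b; rewrite tD tM !eqxx.
Qed.

Lemma semilinearP (tau : {perm F}) (f : {perm 'rV[F]_n}) :
  reflect (forall c1 c2 v1 v2,
             f (c1 *: v1 + c2 *: v2) = tau c1 *: f v1 + tau c2 *: f v2)
          (semilinear tau f).
Proof.
apply: (iffP forallP) => [h c1 c2 v1 v2|h c1].
  by have /forallP/(_ c2)/forallP/(_ v1)/forallP/(_ v2)/eqP := h c1.
by apply/forallP=> c2; apply/forallP=> v1; apply/forallP=> v2; rewrite h.
Qed.

Lemma GammaLP (f : {perm 'rV[F]_n}) :
  reflect (exists2 tau : {perm F}, tau \in field_aut & semilinear tau f)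
          (f \in GammaL).
Proof. by rewrite inE; apply: exists_inP. Qed.

Lemma scalar_mapsP (f : {perm 'rV[F]_n}) :
  reflect (exists2 c : F, c != 0 & forall v, f v = c *: v)
          (f \in scalar_maps).
Proof.
rewrite inE; apply: (iffP existsP) => [[c /andP[c0 /forallP h]]|[c c0 h]].
  by exists c => // v; apply/eqP.
by exists c; rewrite c0; apply/forallP=> v; rewrite h.
Qed.

Lemma field_aut_group_set : group_set field_aut.
Proof.
apply/group_setP; split=> [|s t /field_autP[s1 sD sM] /field_autP[t1 tD tM]].
  by apply/field_autP; split=> [|a b|a b]; rewrite !perm1.
apply/field_autP; split=> [|a b|a b]; rewrite !permM.
- by rewrite s1.
- by rewrite sD tD.
- by rewrite sM tM.
Qed.

Canonical field_aut_group := Group field_aut_group_set.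

Lemma GammaL_group_set : group_set GammaL.
Proof.
apply/group_setP; split=> [|f g /GammaLP[s hs /semilinearP hf]].
  apply/GammaLP; exists 1%g; first exact: group1.
  by apply/semilinearP=> c1 c2 v1 v2; rewrite !perm1.
case/GammaLP=> t ht /semilinearP hg; apply/GammaLP; exists (s * t)%g.
  exact: groupM.
by apply/semilinearP=> c1 c2 v1 v2; rewrite !permM hf hg.
Qed.

Canonical GammaL_group := Group GammaL_group_set.

Lemma scalar_maps_group_set : group_set scalar_maps.
Proof.
apply/group_setP; split=> [|f g /scalar_mapsP[a a0 hf] /scalar_mapsP[b b0 hg]].
  apply/scalar_mapsP; exists 1; first exact: oner_neq0.
  by move=> v; rewrite perm1 scale1r.
apply/scalar_mapsP; exists (b * a); first by rewrite mulf_neq0.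
by move=> v; rewrite permM hf hg scalerA.
Qed.

Canonical scalar_maps_group := Group scalar_maps_group_set.

Lemma scalar_maps_normal : scalar_maps <| GammaL.
Proof.
apply/andP; split; apply/subsetP=> f.
  case/scalar_mapsP=> c _ hf; apply/GammaLP; exists 1%g; first exact: group1.
  apply/semilinearP=> c1 c2 v1 v2.
  by rewrite !perm1 !hf scalerDr !scalerA ![c * _]mulrC.
case/GammaLP=> t /field_autP[t1 tD tM] /semilinearP hf.
rewrite inE; apply/subsetP=> _ /imsetP[s /scalar_mapsP[c c0 hs] ->].
have t0 : t 0 = 0 by apply: (addrI (t 0)); rewrite -tD !addr0.
apply/scalar_mapsP; exists (t c); first by rewrite -t0 (inj_eq perm_inj).
move=> v; rewrite conjgE !permM hs -[c *: _]addr0 -(scale0r 0) hf t0.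
by rewrite scale0r addr0 permKV.
Qed.

(* Since [scalar_maps] is normal in [GammaL], the MathComp quotient is the
   ordinary one. Permutations compose from left to right, so this group is the
   opposite of the one given by composition of maps; inversion is an
   isomorphism between the two. *)
Definition PGammaL := (GammaL / scalar_maps)%g.

Canonical PGammaL_group := Eval hnf in [group of PGammaL].

End SemilinearGroup.

Definition isog_sdprod (gT aT bT : finGroupType) (G : {set gT})
    (N : {set aT}) (Q : {set bT}) : Prop :=
  exists N' Q' : {group gT}, [/\ N' \isog N, Q' \isog Q & N' ><| Q' = G]%g.

(* Main.v *)
(* A semilinear bijection acts on both levels of the graph, with kernel the
   scalars as k < n. Conversely, let phi be an automorphism preserving the two
   levels V_k and V_(k+1). For W of dimension k-1, the images phi(U), U of
   dimension k above W, share a subspace of dimension k-1 (as in Chow's theorem),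
   which extends phi to V_(k-1); descending to V_1 and V_2 yields a collineation,
   which is semilinear by the fundamental theorem of projective geometry (Artin's
   argument), and the semilinear map is seen to induce phi by going back up.

   The graph being connected, an automorphism preserves or exchanges the levels.
   If n >= 2k+2 they cannot be exchanged: two k-spaces are at distance at most
   2k, while two (k+1)-spaces with trivial intersection are at distance at least
   2k+2. If n = 2k+1, orthogonality for the standard bilinear form is an
   involution exchanging the levels. *)
Require Import Defs.
From mathcomp Require Import all_boot all_order all_fingroup all_algebra.
From mathcomp Require Import all_solvable ring zify.

Set Implicit Arguments.
Unset Strict Implicit.
Unset Printing Implicit Defensive.

Import GroupScope GRing.Theory.
Local Open Scope ring_scope.

Import VectorInternalTheory.

(** * Vector identities in coordinates *)

Lemma v2r_add (K : fieldType) (vT : vectType K) :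
  {morph @v2r K vT : u v / u + v}.
Proof. exact: linearD. Qed.

Lemma v2r_opp (K : fieldType) (vT : vectType K) : {morph @v2r K vT : u / - u}.
Proof. exact: linearN. Qed.

Lemma v2r_scale (K : fieldType) (vT : vectType K) c :
  {morph @v2r K vT : u / c *: u}.
Proof. exact: linearZ. Qed.

Lemma v2r_zero (K : fieldType) (vT : vectType K) : v2r (0 : vT) = 0.
Proof. exact: linear0. Qed.

(** Passing to coordinates turns an identity between vectors into scalar identities within reach of
    [ring]. *)
Ltac vector_ring :=
  apply: v2r_inj; apply/rowP=> ?;
  rewrite ?(v2r_add, v2r_opp, v2r_scale, v2r_zero) ?mxE; ring.

(** * Linear independence of two and three vectors *)

Section Independence.

Variables (K : fieldType) (vT : vectType K).
Implicit Types (u v w : vT) (A B U W : {vspace vT}).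

Lemma memv_add2P w u v :
  reflect (exists a b, w = a *: u + b *: v) (w \in (<[u]> + <[v]>)%VS).
Proof.
apply: (iffP memv_addP) => [[_ /vlineP[a ->] [_ /vlineP[b ->] ->]]|[a [b ->]]].
  by exists a, b.
by exists (a *: u); [|exists (b *: v)]; rewrite ?memvZ ?memv_line.
Qed.

Lemma memvZ_eq a v U : a != 0 -> (a *: v \in U) = (v \in U).
Proof.
move=> a0; apply/idP/idP => [h|]; last exact: memvZ.
by rewrite -[v](scalerK a0) memvZ.
Qed.

Lemma vlineZ a v : a != 0 -> <[a *: v]>%VS = <[v]>%VS.
Proof.
move=> a0; apply/eqP; rewrite eqEsubv -!memvE memvZ ?memv_line //=.
by rewrite -(memvZ_eq _ _ a0) memv_line.
Qed.

Lemma vline_eq u v : v != 0 -> v \in <[u]>%VS -> <[v]>%VS = <[u]>%VS.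
Proof.
move=> v0 /vlineP[a def_v]; rewrite def_v vlineZ //.
by apply: contraNneq v0 => a0; rewrite def_v a0 scale0r.
Qed.

Lemma indep2_eq u v a b a' b' : u != 0 -> v \notin <[u]>%VS ->
  a *: u + b *: v = a' *: u + b' *: v -> a = a' /\ b = b'.
Proof.
move=> u0 uv e; have ebb: b = b'.
  apply/eqP; rewrite -subr_eq0; apply: contraNT uv => bb.
  rewrite -(memvZ_eq _ _ bb); apply/vlineP; exists (a' - a).
  apply/eqP; rewrite -subr_eq0; apply/eqP.
  transitivity ((a *: u + b *: v) - (a' *: u + b' *: v)); first by vector_ring.
  by rewrite e subrr.
move: e; rewrite ebb => /addIr/eqP; rewrite -subr_eq0 -scalerBl scaler_eq0.
by rewrite (negPf u0) orbF subr_eq0 => /eqP.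
Qed.

Lemma indep3_eq u v w a b c a' b' c' :
    u != 0 -> v \notin <[u]>%VS -> w \notin (<[u]> + <[v]>)%VS ->
  a *: u + b *: v + c *: w = a' *: u + b' *: v + c' *: w ->
  [/\ a = a', b = b' & c = c'].
Proof.
move=> u0 uv uvw e; have ecc: c = c'.
  apply/eqP; rewrite -subr_eq0; apply: contraNT uvw => cc.
  rewrite -(memvZ_eq _ _ cc); apply/memv_add2P; exists (a' - a), (b' - b).
  apply/eqP; rewrite -subr_eq0; apply/eqP.
  transitivity ((a *: u + b *: v + c *: w) - (a' *: u + b' *: v + c' *: w)).
    by vector_ring.
  by rewrite e subrr.
by move: e; rewrite ecc => /addIr /(indep2_eq u0 uv)[-> ->].
Qed.

Lemma notin_line_neq0 u v : v \notin <[u]>%VS -> v != 0.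
Proof. by apply: contraNneq => ->; rewrite mem0v. Qed.

Lemma indep3_swap u v w : u != 0 -> v \notin <[u]>%VS ->
  w \notin (<[u]> + <[v]>)%VS -> v \notin (<[u]> + <[w]>)%VS.
Proof.
move=> u0 uv uvw; apply/memv_add2P=> -[a [b def_v]].
have: a *: u + (-1) *: v + b *: w = 0 *: u + 0 *: v + 0 *: w.
  by rewrite def_v; vector_ring.
case/(indep3_eq u0 uv uvw) => _ /eqP.
by rewrite oppr_eq0 oner_eq0.
Qed.

Lemma notin_add2_line u v w : w \notin (<[u]> + <[v]>)%VS -> w \notin <[u]>%VS.
Proof. by apply: contra; apply: subvP; apply: addvSl. Qed.

Lemma vline_mem_sym u v : v != 0 -> v \in <[u]>%VS -> u \in <[v]>%VS.
Proof. by move=> v0 /(vline_eq v0) ->; apply: memv_line. Qed.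

Lemma dim_add2_leq u v : (\dim (<[u]> + <[v]>) <= 2)%N.
Proof.
apply: leq_trans (leq_add (leq_b1 (u != 0)) (leq_b1 (v != 0))).
by rewrite -!dim_vline; apply: (dimv_add_leqif _ _).1.
Qed.

Lemma exists_notin_add2 u v : (2 < \dim {: vT})%N ->
  exists w, w \notin (<[u]> + <[v]>)%VS.
Proof.
move=> d3; have: ~~ ({: vT} <= <[u]> + <[v]>)%VS.
  apply/negP=> /dimvS le; have := leq_trans (leq_trans d3 le) (dim_add2_leq u v).
  by rewrite ltnn.
by case/subvPn=> w _; exists w.
Qed.

End Independence.

(** * The fundamental theorem of projective geometry *)

Section FundamentalTheorem.

Variables (K : fieldType) (vT : vectType K) (p : vT -> vT).
Hypothesis p_neq0 : forall v, v != 0 -> p v != 0.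
(** [p v] represents the image of the point of [v]. Since [u] and [v] may be proportional, the
    equivalence covers injectivity on points as well as collinearity. *)
Hypothesis p_add2 : forall u v w, u != 0 -> v != 0 -> w != 0 ->
  (p w \in (<[p u]> + <[p v]>)%VS) = (w \in (<[u]> + <[v]>)%VS).
Hypothesis dim_gt2 : (2 < \dim {: vT})%N.

Lemma p_line u w : u != 0 -> w != 0 ->
  (p w \in <[p u]>%VS) = (w \in <[u]>%VS).
Proof. by move=> u0 w0; rewrite -[<[p u]>%VS]addvv p_add2 ?addvv. Qed.

Section BaseVector.

Variable e : vT.
Hypothesis e_neq0 : e != 0.

Lemma addr_notin_line v : (e + v \in <[e]>%VS) = (v \in <[e]>%VS).
Proof. by rewrite rpredDl ?memv_line. Qed.

(** The vector [p (e + v)] is [a *: p e + b *: p v], with [a] nonzero because [e + v] is off the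
    line of [v]; dividing by [a] gives [w]. The boolean implication makes the statement total in
    [v], so that [xchoose] applies. *)
Lemma lift_exists v : exists w,
  (v \notin <[e]>%VS) ==> (w \in <[p v]>%VS) && (p (e + v) \in <[p e + w]>%VS).
Proof.
have [ev|ev] := boolP (v \in <[e]>%VS); first by exists 0.
have v0 := notin_line_neq0 ev.
have ev' : e + v \notin <[e]>%VS by rewrite addr_notin_line.
have ev0 := notin_line_neq0 ev'.
have : p (e + v) \in (<[p e]> + <[p v]>)%VS.
  by rewrite p_add2 // memv_add ?memv_line.
case/memv_add2P=> a [b def_p]; have a0 : a != 0.
  apply: contraNneq ev => a0; apply: (vline_mem_sym e_neq0).
  have : p (e + v) \in <[p v]>%VS.
    by rewrite def_p a0 scale0r add0r memvZ ?memv_line.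
  by rewrite p_line // rpredDr ?memv_line.
exists (a^-1 *: (b *: p v)); apply/andP; split; first by rewrite !memvZ ?memv_line.
by apply/vlineP; exists a; rewrite scalerDr scalerKV // def_p.
Qed.

(* [lift v] is the representative of the point [p v] normalised by
   [p (e + v) = <e' + lift v>], where [e' = p e]. *)
Definition lift v := xchoose (lift_exists v).

Lemma lift_line v : v \notin <[e]>%VS -> <[lift v]>%VS = <[p v]>%VS.
Proof.
move=> ev; have /implyP/(_ ev)/andP[lv pv] := xchooseP (lift_exists v).
apply: vline_eq lv; apply: contraNneq (ev) => l0; move: pv; rewrite l0 addr0.
rewrite p_line ?addr_notin_line //.
by apply: (@notin_line_neq0 _ _ e); rewrite addr_notin_line.
Qed.

Lemma lift_add_base v : v \notin <[e]>%VS -> p (e + v) \in <[p e + lift v]>%VS.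
Proof. by move=> ev; have /implyP/(_ ev)/andP[] := xchooseP (lift_exists v). Qed.

Lemma p_notin_base v : v \notin <[e]>%VS -> p v \notin <[p e]>%VS.
Proof. by move=> ev; rewrite p_line // (notin_line_neq0 ev). Qed.

Lemma lift_notin_base v : v \notin <[e]>%VS -> lift v \notin <[p e]>%VS.
Proof. by move=> ev; rewrite memvE lift_line // -memvE p_notin_base. Qed.

Lemma lift_neq0 v : v \notin <[e]>%VS -> lift v != 0.
Proof. by move/lift_notin_base/notin_line_neq0. Qed.

(** For [w = b *: lift v], comparing the coefficients of [p (e + v)] along the independent vectors
    [p e] and [lift v] gives [a * b = a] with [a] nonzero. *)
Lemma lift_uniq v w : v \notin <[e]>%VS ->
  w \in <[p v]>%VS -> p (e + v) \in <[p e + w]>%VS -> w = lift v.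
Proof.
move=> ev; rewrite -(lift_line ev) => /vlineP[b ->] /vlineP[a def_p].
have ev0 : e + v != 0.
  by apply: (@notin_line_neq0 _ _ e); rewrite addr_notin_line.
have /vlineP[a' def_p'] := lift_add_base ev.
have: a *: p e + (a * b) *: lift v = a' *: p e + a' *: lift v.
  by rewrite -scalerDr -def_p' def_p; vector_ring.
case/(indep2_eq (p_neq0 e_neq0) (lift_notin_base ev)) => <-.
move=> /eqP; rewrite -{2}[a]mulr1 -subr_eq0 -mulrBr mulf_eq0 subr_eq0.
case/orP=> /eqP ab; last by rewrite ab scale1r.
by have := p_neq0 ev0; rewrite def_p ab scale0r eqxx.
Qed.

Lemma lift_indep u v : u \notin <[e]>%VS -> v \notin (<[e]> + <[u]>)%VS ->
  lift v \notin (<[p e]> + <[lift u]>)%VS.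
Proof.
move=> eu euv; have ev := notin_add2_line euv.
by rewrite memvE !lift_line // -memvE p_add2 // (notin_line_neq0 eu, notin_line_neq0 ev).
Qed.

Lemma p_mem_lift u v w : u \notin <[e]>%VS -> v \notin <[e]>%VS -> w != 0 ->
  w \in (<[u]> + <[v]>)%VS -> p w \in (<[lift u]> + <[lift v]>)%VS.
Proof.
move=> eu ev w0; rewrite !lift_line // p_add2 //.
  exact: notin_line_neq0 eu.
exact: notin_line_neq0 ev.
Qed.

Lemma p_mem_base_lift u v w : u \notin <[e]>%VS -> v \notin <[e]>%VS -> w != 0 ->
  w \in (<[e + u]> + <[v]>)%VS -> p w \in (<[p e + lift u]> + <[lift v]>)%VS.
Proof.
move=> eu ev w0; have eu' : e + u \notin <[e]>%VS by rewrite addr_notin_line.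
have eu0 := notin_line_neq0 eu'.
rewrite -(vline_eq (p_neq0 eu0) (lift_add_base eu)) lift_line // p_add2 //.
exact: notin_line_neq0 ev.
Qed.

(* The point of [e + u + v] is on the line of [e + u] and [v] and on that of
   [e + v] and [u], hence its image is [<p e + lift u + lift v>]; then [u + v]
   is on the line of [e] and [e + u + v]. *)
Lemma liftD u v : u \notin <[e]>%VS -> v \notin (<[e]> + <[u]>)%VS ->
  lift (u + v) = lift u + lift v.
Proof.
move=> eu euv; have ev := notin_add2_line euv.
have euv' : u + v \notin <[e]>%VS.
  apply: contra euv => h; rewrite -[v](addKr u).
  rewrite addrC memv_add // rpredN memv_line //.
have x0 : e + (u + v) != 0.
  by apply: (@notin_line_neq0 _ _ e); rewrite addr_notin_line.
have uv0 := notin_line_neq0 euv'.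
have [[E0 Lu] Lv] := (p_neq0 e_neq0, lift_notin_base eu, lift_indep eu euv).
have [a [b def1]]: exists a b,
    p (e + (u + v)) = a *: (p e + lift u) + b *: lift v.
  apply/memv_add2P/p_mem_base_lift => //.
  by rewrite addrA memv_add ?memv_line.
have [c [d def2]]: exists a b,
    p (e + (u + v)) = a *: (p e + lift v) + b *: lift u.
  apply/memv_add2P/p_mem_base_lift => //.
  by rewrite [u + v]addrC addrA memv_add ?memv_line.
have: a *: p e + a *: lift u + b *: lift v = c *: p e + d *: lift u + c *: lift v.
  transitivity (p (e + (u + v))); first by rewrite def1; vector_ring.
  by rewrite def2; vector_ring.
case/(indep3_eq E0 Lu Lv) => eac ead ebc; rewrite -{}eac in ebc.
rewrite {b}ebc {c d ead def2} in def1.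
have {}def1 : p (e + (u + v)) = a *: (p e + (lift u + lift v)).
  by rewrite def1; vector_ring.
have a0 : a != 0.
  by apply: contraNneq (p_neq0 x0) => a0; rewrite def1 a0 scale0r.
apply/esym/lift_uniq => //; last by rewrite def1 memvZ ?memv_line.
have [a' [b' def3]]: exists a b, p (u + v) = a *: lift u + b *: lift v.
  by apply/memv_add2P/p_mem_lift => //; rewrite memv_add ?memv_line.
have: p (u + v) \in (<[p e]> + <[p (e + (u + v))]>)%VS.
  rewrite p_add2 //; apply/memv_add2P; exists (-1), 1; vector_ring.
rewrite def1 vlineZ // => /memv_add2P[c [d def4]].
have: 0 *: p e + a' *: lift u + b' *: lift v
      = (c + d) *: p e + d *: lift u + d *: lift v.
  transitivity (p (u + v)); first by rewrite def3; vector_ring.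
  by rewrite def4; vector_ring.
case/(indep3_eq E0 Lu Lv) => _ ea' eb'.
apply: vline_mem_sym; first exact: p_neq0.
by apply/vlineP; exists d; rewrite def3 ea' eb' scalerDr.
Qed.

(** The vector [lift (c *: (u + v))] is both a multiple of [lift u + lift v] and the sum of
    [lift (c *: u)] and [lift (c *: v)]; by independence the factors at [u] and at [v] agree. *)
Lemma lift_scale_transfer u v c t : c != 0 ->
    u \notin <[e]>%VS -> v \notin (<[e]> + <[u]>)%VS ->
  lift (c *: u) = t *: lift u -> lift (c *: v) = t *: lift v.
Proof.
move=> c0 eu euv lu; have ev := notin_add2_line euv.
have lineZ w : w \notin <[e]>%VS -> exists t, lift (c *: w) = t *: lift w.
  move=> ew; have ecw : c *: w \notin <[e]>%VS by rewrite memvZ_eq.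
  apply/vlineP; rewrite lift_line // memvE lift_line // -memvE.
  by rewrite p_line ?(notin_line_neq0 ew) ?(notin_line_neq0 ecw) ?memvZ ?memv_line.
have [s lv] := lineZ v ev.
have euv' : u + v \notin <[e]>%VS.
  apply: contra euv => h; rewrite -[v](addKr u).
  by rewrite addrC memv_add // rpredN memv_line.
have [r luv] := lineZ _ euv'.
have ecucv : c *: v \notin (<[e]> + <[c *: u]>)%VS by rewrite vlineZ // memvZ_eq.
have: 0 *: p e + t *: lift u + s *: lift v = 0 *: p e + r *: lift u + r *: lift v.
  rewrite -lu -lv -!addrA -scalerDr -[lift u + lift v]liftD // -luv scalerDr.
  by rewrite (liftD _ ecucv) // memvZ_eq.
case/(indep3_eq (p_neq0 e_neq0) (lift_notin_base eu) (lift_indep eu euv)).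
by move=> _ -> <-.
Qed.

(** The factor is read off at one vector [u] outside [<[e]>], then transferred to all others. *)
Lemma twist_exists : exists tau : K -> K, tau 0 = 0 /\
  forall c v, c != 0 -> v \notin <[e]>%VS -> lift (c *: v) = tau c *: lift v.
Proof.
have [u] := exists_notin_add2 e e dim_gt2; rewrite addvv => eu.
have ex c : exists t, if c == 0 then t == 0 else lift (c *: u) == t *: lift u.
  have [c0|c0] := eqVneq; first by exists 0.
  have ecu : c *: u \notin <[e]>%VS by rewrite memvZ_eq.
  have: lift (c *: u) \in <[lift u]>%VS.
    rewrite lift_line // memvE lift_line // -memvE.
    by rewrite p_line ?(notin_line_neq0 eu) ?(notin_line_neq0 ecu) ?memvZ ?memv_line.
  by case/vlineP=> t ->; exists t.
have [tau tauP] : exists tau : K -> K, forall c,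
    if c == 0 then tau c == 0 else lift (c *: u) == tau c *: lift u.
  by exists (fun c => xchoose (ex c)) => c; apply: (xchooseP (ex c)).
exists tau; split; first by have := tauP 0; rewrite eqxx => /eqP.
move=> c v c0 ev; have := tauP c; rewrite (negPf c0) => /eqP lcu.
have [euv|euv] := boolP (v \in (<[e]> + <[u]>)%VS); last first.
  exact: (lift_scale_transfer c0 eu).
(* For [v] in the plane of [e] and [u] the transfer is not direct; it goes from [u] to [w] outside
   that plane, then from [w] to [v]. *)
have [w euw] := exists_notin_add2 e u dim_gt2.
have ew := notin_add2_line euw.
apply: (lift_scale_transfer c0 ew); last exact: (lift_scale_transfer c0 eu).
apply: indep3_swap => //; apply: contra euw; apply: subvP.
by rewrite subv_add addvSl -memvE.
Qed.

End BaseVector.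

(** With [e] the first basis vector, [pi] its coordinate and [h v = v - pi v *: e], the map [f]
    sends [v] to [tau (pi v) *: p e + lift (h v)], the last term being 0 when [h v = 0]. The
    hyperplane [pi = 0] meets [<[e]>] trivially, so [lift] is available on its nonzero vectors. *)
Theorem fundamental_theorem : exists (tau : K -> K) (f : vT -> vT),
  [/\ [/\ tau 1 = 1, {morph tau : a b / a + b} & {morph tau : a b / a * b}],
      forall c1 c2 v1 v2,
        f (c1 *: v1 + c2 *: v2) = tau c1 *: f v1 + tau c2 *: f v2 &
      forall v, v != 0 -> <[f v]>%VS = <[p v]>%VS].
Proof.
have d0 : (0 < \dim {: vT})%N by apply: leq_trans dim_gt2.
pose i0 := Ordinal d0; pose e := (vbasis {: vT})`_i0.
pose pi := coord (vbasis {: vT}) i0.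
have pi_e : pi e = 1.
  by rewrite /pi /e coord_free ?eqxx // (basis_free (vbasisP _)).
have piD u v : pi (u + v) = pi u + pi v by rewrite /pi linearD.
have piZ c v : pi (c *: v) = c * pi v by rewrite /pi linearZ.
have e0 : e != 0.
  apply: contra_eq_neq pi_e => ->; rewrite /pi linear0 eq_sym; exact: oner_neq0.
have [tau [tau0 tauP]] := twist_exists e0.
pose h v := v - pi v *: e.
have hD u v : h (u + v) = h u + h v.
  by rewrite /h piD; vector_ring.
have hZ c v : h (c *: v) = c *: h v.
  by rewrite /h piZ; vector_ring.
have pi_h v : pi (h v) = 0 by rewrite /h piD -scaleNr piZ pi_e mulr1 subrr.
have ker_line v : pi v = 0 -> v \in <[e]>%VS -> v = 0.
  move=> piv0 /vlineP[c def_v]; move: piv0.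
  by rewrite def_v piZ pi_e mulr1 => ->; rewrite scale0r.
have h_notin v : h v != 0 -> h v \notin <[e]>%VS.
  by apply: contra => /(ker_line _ (pi_h v)) ->.
have [u] := exists_notin_add2 e e dim_gt2; rewrite addvv => eu.
have [v euv] := exists_notin_add2 e u dim_gt2.
have ev := notin_add2_line euv.
have lu0 : lift e0 u != 0 by apply: lift_neq0.
have tau1 : tau 1 = 1.
  have := tauP 1 u (oner_neq0 _) eu; rewrite scale1r -{1}[lift e0 u]scale1r.
  by move/eqP; rewrite -subr_eq0 -scalerBl scaler_eq0 (negPf lu0) orbF subr_eq0 => /eqP.
have tauM : {morph tau : a b / a * b}.
  move=> a b; have [->|a0] := eqVneq a 0; first by rewrite mul0r tau0 mul0r.
  have [->|b0] := eqVneq b 0; first by rewrite mulr0 tau0 mulr0.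
  have ebu : b *: u \notin <[e]>%VS by rewrite memvZ_eq.
  have := tauP _ _ (mulf_neq0 a0 b0) eu; rewrite -scalerA !tauP // scalerA.
  move/eqP; rewrite -subr_eq0 -scalerBl scaler_eq0 (negPf lu0) orbF subr_eq0.
  by move/eqP.
have lift_lin c x y : x \notin <[e]>%VS -> y \notin (<[e]> + <[x]>)%VS ->
    lift e0 (c *: x + y) = tau c *: lift e0 x + lift e0 y.
  move=> ex exy; have [->|c0] := eqVneq c 0.
    by rewrite tau0 !scale0r !add0r.
  by rewrite liftD ?vlineZ ?memvZ_eq // tauP.
(* [liftD] does not apply to the proportional [a *: u] and [b *: u]; adding the independent [v] to
   one of them makes it apply. *)
have tauD : {morph tau : a b / a + b}.
  move=> a b.
  have ebuv : b *: u + v \notin (<[e]> + <[u]>)%VS.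
    by rewrite rpredDl // (subvP (addvSr _ _)) // memvZ ?memv_line.
  have := lift_lin (a + b) u v eu euv.
  rewrite scalerDl -addrA !lift_lin // addrA -scalerDl => /addIr/eqP.
  rewrite -subr_eq0 -scalerBl scaler_eq0 (negPf lu0) orbF subr_eq0.
  by move/eqP/esym.
pose g w := if w == 0 then 0 else lift e0 w.
have gZ c v1 : g (c *: h v1) = tau c *: g (h v1).
  rewrite /g scaler_eq0 /=; have [->|c0] := eqVneq c 0; first by rewrite tau0 !scale0r.
  have [|hv0] := eqVneq (h v1) 0; first by rewrite scaler0.
  by rewrite tauP ?h_notin.
have gD v1 v2 : g (h v1 + h v2) = g (h v1) + g (h v2).
  have [h10|h10] := eqVneq (h v1) 0; first by rewrite h10 add0r /g eqxx add0r.
  have e1 := h_notin _ h10.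
  (* In the dependent case [pi] kills the component along [e], so [h v2] is a multiple of [h v1] and
     additivity of [tau] replaces [liftD]. *)
  have [e12|e12] := boolP (h v2 \in (<[e]> + <[h v1]>)%VS).
    have [a [b def2]] := memv_add2P _ _ _ e12.
    have a0 : a = 0.
      have := pi_h v2; rewrite def2 piD !piZ pi_e pi_h.
      by rewrite mulr1 mulr0 addr0.
    move: def2; rewrite a0 scale0r add0r => ->.
    rewrite -{1}[h v1]scale1r -scalerDl !gZ tauD tau1 scalerDl scale1r //.
  have h20 : h v2 != 0 := notin_line_neq0 (notin_add2_line e12).
  have h120 : h v1 + h v2 != 0.
    apply: contraNneq e12 => h120; have ->: h v2 = - h v1.
      by apply/eqP; rewrite -addr_eq0 addrC h120.
    by rewrite rpredN (subvP (addvSr _ _)) ?memv_line.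
  by rewrite /g (negPf h10) (negPf h20) (negPf h120) liftD.
exists tau, (fun v => tau (pi v) *: p e + g (h v)); split=> //.
  move=> c1 c2 v1 v2; rewrite hD gD !hZ !gZ piD !piZ tauD !tauM.
  by vector_ring.
move=> w w0; have def_w : w = pi w *: e + h w by rewrite /h addrCA subrr addr0.
have taun0 c : c != 0 -> tau c != 0.
  move=> c0; apply: contra_eq_neq tau1 => tc0.
  by rewrite -{1}(mulfV c0) tauM tc0 mul0r eq_sym oner_neq0.
have [hw0|hw0] := eqVneq (h w) 0.
  rewrite hw0 /g eqxx addr0.
  have piw0 : pi w != 0.
    by apply: contraNneq w0 => piw0; rewrite def_w piw0 hw0 scale0r addr0.
  rewrite vlineZ ?taun0 //; apply/esym/vline_eq; first exact: p_neq0.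
  by rewrite p_line // def_w hw0 addr0 memvZ ?memv_line.
have [piw0|piw0] := eqVneq (pi w) 0.
  rewrite piw0 tau0 scale0r add0r /g (negPf hw0) lift_line ?h_notin //.
  by rewrite [in RHS]def_w piw0 scale0r add0r.
have ehw := h_notin _ hw0.
(* The point of [w] is that of [e + x], whose image is spanned by [p e + lift x] by the
   normalisation of [lift]; scaling by [tau (pi w)] gives the proposed value at [w]. *)
pose x := (pi w)^-1 *: h w.
have ex : x \notin <[e]>%VS by rewrite memvZ_eq ?invr_eq0.
have ex0 : e + x != 0.
  by apply: (@notin_line_neq0 _ _ e); rewrite addr_notin_line.
have def_w' : w = pi w *: (e + x) by rewrite scalerDr scalerA mulfV // scale1r.
have -> : <[p w]>%VS = <[p (e + x)]>%VS.
  apply: vline_eq; first exact: p_neq0.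
  by rewrite p_line // def_w' memvZ ?memv_line.
rewrite (vline_eq _ (lift_add_base e0 ex)) ?p_neq0 //.
rewrite -[RHS](vlineZ _ (taun0 _ piw0)) scalerDr -tauP // scalerA mulfV // scale1r.
by rewrite /g (negPf hw0).
Qed.

End FundamentalTheorem.

(** * Dimensions of sums and intersections *)

Section Subspaces.

Variables (K : fieldType) (vT : vectType K).
Implicit Types (u v w : vT) (A B U W X : {vspace vT}).

Lemma dim_add_line A w : w \notin A -> \dim (A + <[w]>) = (\dim A).+1.
Proof.
move=> Aw; have w0 : w != 0 by apply: contraNneq Aw => ->; rewrite mem0v.
rewrite dimv_disjoint_sum ?dim_vline ?w0 ?addn1 //.
apply/eqP; rewrite -subv0; apply/subvP=> x /memv_capP[Ax /vlineP[c def_x]].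
rewrite memv0; apply: contraNT Aw => x0.
rewrite -(memvZ_eq _ _ (_ : c != 0)) -?def_x //.
by apply: contraNneq x0 => c0; rewrite def_x c0 scale0r.
Qed.

Lemma eq_dim_sub U W : (U <= W)%VS -> \dim U = \dim W -> U = W.
Proof. by move=> sUW dUW; apply/eqP; rewrite eqEdim sUW dUW leqnn. Qed.

Lemma exists_between A B m : (A <= B)%VS -> (\dim A <= m <= \dim B)%N ->
  exists U, [/\ (A <= U)%VS, (U <= B)%VS & \dim U = m].
Proof.
move=> sAB /andP[]; move Dd: (m - \dim A)%N => d.
elim: d A sAB Dd => [|d IH] A sAB Dd leAm lemB.
  exists A; split=> //; apply/eqP; rewrite eqn_leq leAm /=.
  by rewrite -subn_eq0 Dd.
have ltAm : (\dim A < m)%N by rewrite -subn_gt0 Dd.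
have /subvPn[w Bw Aw] : ~~ (B <= A)%VS.
  by apply/negP=> /dimvS; rewrite leqNgt (leq_trans ltAm).
have [||||U [sU ? ?]] := IH (A + <[w]>)%VS => //.
- by rewrite subv_add sAB -memvE.
- by rewrite dim_add_line // subnS Dd.
- by rewrite dim_add_line.
by exists U; split=> //; apply: subv_trans sU; apply: addvSl.
Qed.

Lemma ltn_dim_addv m U W : \dim U = m -> \dim W = m -> U != W ->
  (m < \dim (U + W))%N.
Proof.
move=> dU dW nUW; rewrite ltn_neqAle -{2}dU dimvS ?addvSl // andbT.
apply: contra nUW => /eqP d; apply/eqP.
by rewrite (eq_dim_sub (addvSl U W)) -?d // -(eq_dim_sub (addvSr U W)) -?d.
Qed.

Lemma ltn_dim_neq_full U : (\dim U < \dim {: vT})%N -> U != {: vT}%VS.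
Proof. by apply: contraTneq => ->; rewrite ltnn. Qed.

Lemma hyperplanes_add_cap j X U W : \dim X = j.+2 ->
    \dim U = j.+1 -> \dim W = j.+1 -> U != W -> (U <= X)%VS -> (W <= X)%VS ->
  (U + W)%VS = X /\ \dim (U :&: W)%VS = j.
Proof.
move=> dX dU dW nUW sUX sWX.
have sX : (U + W <= X)%VS by rewrite subv_add sUX.
have dUW := ltn_dim_addv dU dW nUW.
have eX : (U + W)%VS = X.
  apply: eq_dim_sub => //; apply/eqP.
  by rewrite eqn_leq dimvS //= dX.
split=> //; have := dimv_sum_cap U W; rewrite eX dX dU dW.
by rewrite addnS !addSn => -[]; move/eqP; rewrite eqn_add2l => /eqP.
Qed.

End Subspaces.

(** * Isomorphisms between consecutive levels, and their descent *)

Section Levels.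

Variables (K : fieldType) (vT : vectType K).
Implicit Types (U W X : {vspace vT}) (f g : {vspace vT} -> {vspace vT}).

Definition level j U := (\dim U == j) || (\dim U == j.+1).

(** The maps are total on subspaces but constrained on levels [j] and [j.+1] only, so that descent
    changes [j] without changing their type. *)
Definition level_embedding j f g :=
  [/\ forall U, level j U -> \dim (f U) = \dim U,
      forall U, level j U -> g (f U) = U &
      forall U W, \dim U = j -> \dim W = j.+1 -> (U <= W)%VS -> (f U <= f W)%VS].

Definition level_iso j f g := level_embedding j f g /\ level_embedding j g f.

Lemma level_iso_sym j f g : level_iso j f g -> level_iso j g f.
Proof. by case=> ? ?; split. Qed.

Lemma level0 j U : \dim U = j -> level j U.
Proof. by rewrite /level => ->; rewrite eqxx. Qed.

Lemma level1 j U : \dim U = j.+1 -> level j U.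
Proof. by rewrite /level => ->; rewrite eqxx orbT. Qed.

Section LevelIso.

Variables (j : nat) (f g : {vspace vT} -> {vspace vT}).
Hypothesis fg : level_iso j f g.

Lemma level_iso_dim U : level j U -> \dim (f U) = \dim U.
Proof. by case: fg => -[h _ _] _; apply: h. Qed.

Lemma level_isoK U : level j U -> g (f U) = U.
Proof. by case: fg => -[_ h _] _; apply: h. Qed.

Lemma level_iso_sub U W : \dim U = j -> \dim W = j.+1 ->
  (f U <= f W)%VS = (U <= W)%VS.
Proof.
move=> dU dW; case: fg => -[_ _ hf] [_ _ hg]; apply/idP/idP; last exact: hf.
move/hg; rewrite (level_isoK (level0 dU)) (level_isoK (level1 dW)).
by apply; rewrite level_iso_dim ?(level0 dU) ?(level1 dW).
Qed.

Lemma level_iso_inj U W : level j U -> level j W -> (f U == f W) = (U == W).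
Proof.
move=> lU lW; apply/eqP/eqP=> [|->] //.
by move/(congr1 g); rewrite !level_isoK.
Qed.

End LevelIso.

Section Descent.

Variables (j : nat) (f g : {vspace vT} -> {vspace vT}).
Hypothesis fg : level_iso j.+1 f g.
Hypothesis j_lt : (j.+2 < \dim {: vT})%N.

(* [f U] meets each of [f U1], [f U2] in dimension [j] but is not inside
   [f (U1 + U2)], so both intersections are [f U :&: f (U1 + U2)]. *)
Lemma star_triple W U1 U2 U : \dim W = j ->
    \dim U1 = j.+1 -> \dim U2 = j.+1 -> \dim U = j.+1 ->
    (W <= U1)%VS -> (W <= U2)%VS -> (W <= U)%VS ->
    U1 != U2 -> ~~ (U <= U1 + U2)%VS ->
  \dim (f U1 :&: f U2)%VS = j /\ (f U1 :&: f U2 <= f U)%VS.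
Proof.
move=> dW dU1 dU2 dU sW1 sW2 sW n12 nU.
have dD A B : \dim A = j.+1 -> \dim B = j.+1 -> A != B ->
    (W <= A)%VS -> (W <= B)%VS -> \dim (A + B) = j.+2.
  move=> dA dB nAB sA sB; apply/eqP; rewrite eqn_leq (ltn_dim_addv dA) // andbT.
  have sWAB : (W <= A :&: B)%VS by rewrite subv_cap sA.
  rewrite -(leq_add2r j) -{1}dW (leq_trans (leq_add (leqnn _) (dimvS sWAB))) //.
  by rewrite dimv_sum_cap dA dB addSnnS addnC.
have dcap A B : \dim A = j.+1 -> \dim B = j.+1 -> A != B ->
    (W <= A)%VS -> (W <= B)%VS -> \dim (f A :&: f B) = j.
  move=> dA dB nAB sA sB; have dAB := dD A B dA dB nAB sA sB.
  apply: (proj2 (@hyperplanes_add_cap _ _ j (f (A + B)%VS) _ _ _ _ _ _ _ _)).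
  - by rewrite (level_iso_dim fg) ?level1.
  - by rewrite (level_iso_dim fg) ?level0.
  - by rewrite (level_iso_dim fg) ?level0.
  - by rewrite (level_iso_inj fg) ?level0.
  - by rewrite (level_iso_sub fg) ?addvSl.
  - by rewrite (level_iso_sub fg) ?addvSr.
have d12 := dD U1 U2 dU1 dU2 n12 sW1 sW2.
have nU1 : U != U1 by apply: contraNneq nU => ->; apply: addvSl.
have nU2 : U != U2 by apply: contraNneq nU => ->; apply: addvSr.
have nfU : ~~ (f U <= f (U1 + U2))%VS by rewrite (level_iso_sub fg).
split; first exact: dcap.
have dX : (\dim (f U :&: f (U1 + U2)) <= j)%N.
  rewrite -ltnS -dU -[\dim U](level_iso_dim fg) ?level0 //.
  rewrite ltn_neqAle dimvS ?capvSl // andbT.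
  apply: contra nfU => /eqP d.
  by rewrite -(eq_dim_sub (capvSl _ _) d) capvSr.
have eqX V : \dim V = j.+1 -> (W <= V)%VS -> U != V -> (V <= U1 + U2)%VS ->
    (f U :&: f V)%VS = (f U :&: f (U1 + U2))%VS.
  move=> dV sV nUV sV12.
  have s : (f U :&: f V <= f U :&: f (U1 + U2))%VS.
    by rewrite capvS // (level_iso_sub fg).
  apply: (eq_dim_sub s); apply/eqP; rewrite eqn_leq dimvS //=.
  by rewrite [X in (_ <= X)%N]dcap.
have e12 : (f U :&: f U1)%VS = (f U :&: f U2)%VS.
  by rewrite !eqX ?addvSl ?addvSr.
have s12 : (f U :&: f U1 <= f U1 :&: f U2)%VS.
  by rewrite subv_cap capvSr e12 capvSr.
by rewrite -(eq_dim_sub s12) ?dcap // capvSl.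
Qed.

(* The images of all [U] of dimension [j.+1] above [W] share a subspace of
   dimension [j]; two such [U] suffice to compute it. *)
Definition center W :=
  let U := (W + <[vpick W^C]>)%VS in (f U :&: f (W + <[vpick U^C]>))%VS.

Lemma vpick_compl U : U != {: vT}%VS -> vpick U^C \notin U.
Proof.
move=> nU; have: vpick U^C != 0.
  rewrite vpick0; apply: contra nU => /eqP U0.
  by rewrite -(addv_complf U) U0 addv0.
apply: contra => pU; rewrite -memv0 -(capv_compl U) memv_cap pU; exact: memv_pick.
Qed.

(** [star_triple] with [U1] and [U2] settles every [U] not inside [U1 + U2]. For the others [U2] is
    replaced by a third subspace [U3], chosen outside [U1 + U2]. *)
Lemma center_star W : \dim W = j ->
  \dim (center W) = j /\
  forall U, \dim U = j.+1 -> (W <= U)%VS -> (center W <= f U)%VS.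
Proof.
move=> dW; rewrite /center /=.
set w1 := vpick W^C; set U1 := (W + <[w1]>)%VS.
set w2 := vpick U1^C; set U2 := (W + <[w2]>)%VS.
have Ww1 : w1 \notin W by rewrite vpick_compl ?ltn_dim_neq_full ?dW // 2?ltnW.
have dU1 : \dim U1 = j.+1 by rewrite dim_add_line ?dW.
have U1w2 : w2 \notin U1 by rewrite vpick_compl ?ltn_dim_neq_full ?dU1 // ltnW.
have sWU1 : (W <= U1)%VS by apply: addvSl.
have sWU2 : (W <= U2)%VS by apply: addvSl.
have Ww2 : w2 \notin W by apply: contra U1w2; apply: subvP.
have dU2 : \dim U2 = j.+1 by rewrite dim_add_line ?dW.
have w2U2 : w2 \in U2 by rewrite (subvP (addvSr _ _)) ?memv_line.
have n12 : U1 != U2 by apply: contraNneq U1w2 => ->.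
have e12 : (U1 + U2)%VS = (U1 + <[w2]>)%VS.
  by rewrite /U2 addvA (addv_idPl sWU1).
have d12 : \dim (U1 + U2) = j.+2 by rewrite e12 dim_add_line ?dU1.
(* This is where [j.+2 < \dim {: vT}] matters: [U1 + U2] has dimension [j.+2] and must not be the
   full space. *)
set w3 := vpick (U1 + U2)^C; pose U3 := (W + <[w3]>)%VS.
have w3n : w3 \notin (U1 + U2)%VS by rewrite vpick_compl ?ltn_dim_neq_full ?d12.
have Ww3 : w3 \notin W.
  by apply: contra w3n; apply: subvP; rewrite (subv_trans sWU1) ?addvSl.
have dU3 : \dim U3 = j.+1 by rewrite dim_add_line ?dW.
have sWU3 : (W <= U3)%VS by apply: addvSl.
have w3U3 : w3 \in U3 by rewrite (subvP (addvSr _ _)) ?memv_line.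
have nU3 : ~~ (U3 <= U1 + U2)%VS by apply: contra w3n => /subvP->.
have [dc sc3] := star_triple dW dU1 dU2 dU3 sWU1 sWU2 sWU3 n12 nU3.
split=> // U dU sWU; have [sU12|nU12] := boolP (U <= U1 + U2)%VS; last first.
  exact: (proj2 (star_triple dW dU1 dU2 dU sWU1 sWU2 sWU n12 nU12)).
have [->|nUU1] := eqVneq U U1; first exact: capvSl.
have n13 : U1 != U3 by apply: contraNneq w3n => e; rewrite (subvP (addvSl _ _)) ?e.
(* Otherwise [U + U1] would equal both [U1 + U2] and [U1 + U3], putting [U3] inside [U1 + U2]. *)
have nU13 : ~~ (U <= U1 + U3)%VS.
  apply: contra nU3 => sU13.
  have dU1U : \dim (U + U1) = j.+2.
    apply/eqP; rewrite eqn_leq (ltn_dim_addv dU) // andbT -d12 dimvS //.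
    by rewrite subv_add sU12 addvSl.
  have e13 : (U1 + U3)%VS = (U1 + <[w3]>)%VS.
    by rewrite /U3 addvA (addv_idPl sWU1).
  have d13 : \dim (U1 + U3) = j.+2.
    by rewrite e13 dim_add_line ?dU1 //; apply: contra w3n; apply/subvP/addvSl.
  have <-: (U + U1)%VS = (U1 + U2)%VS.
    by apply: eq_dim_sub; rewrite ?d12 // subv_add sU12 addvSl.
  have ->: (U + U1)%VS = (U1 + U3)%VS.
    by apply: eq_dim_sub; rewrite ?d13 // subv_add sU13 addvSl.
  exact: addvSr.
have [d13 s13] := star_triple dW dU1 dU3 dU sWU1 sWU3 sWU n13 nU13.
apply: subv_trans s13; rewrite subv_cap capvSl; exact: sc3.
Qed.

End Descent.

Definition descend j f W := if \dim W == j then center f W else f W.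

(** For the inverse property: every [V] of dimension [j.+1] above [U] is [g (f V)], hence contains
    [center g (center f U)]. Since [U] is the intersection of two such [V], it contains that
    subspace too, and the dimensions agree. *)
Lemma descend_embedding j f g : level_iso j.+1 f g -> (j.+2 < \dim {: vT})%N ->
  level_embedding j (descend j f) (descend j g).
Proof.
move=> fg j_lt; have gf := level_iso_sym fg.
have nj : (j.+1 == j) = false by rewrite gtn_eqF.
have dimf U : \dim U = j.+1 -> \dim (f U) = j.+1.
  by move=> dU; rewrite (level_iso_dim fg) ?level0.
split=> [U|U|U W dU dW sUW].
- rewrite /descend => /orP[/eqP dU|/eqP dU]; rewrite dU ?eqxx ?nj ?dimf //.
  exact: (center_star fg j_lt dU).1.
- rewrite /descend => /orP[/eqP dU|/eqP dU]; rewrite dU ?eqxx ?nj; last first.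
    by rewrite dimf // nj (level_isoK fg) ?level0.
  have [dc sc] := center_star fg j_lt dU; rewrite dc eqxx.
  have [dcc scc] := center_star gf j_lt dc.
  apply: eq_dim_sub; last by rewrite dcc.
  pose w1 := vpick U^C; pose U1 := (U + <[w1]>)%VS.
  pose w2 := vpick U1^C; pose U2 := (U + <[w2]>)%VS.
  have Uw1 : w1 \notin U by rewrite vpick_compl ?ltn_dim_neq_full ?dU // 2?ltnW.
  have dU1 : \dim U1 = j.+1 by rewrite dim_add_line ?dU.
  have U1w2 : w2 \notin U1 by rewrite vpick_compl ?ltn_dim_neq_full ?dU1 // ltnW.
  have sU1 : (U <= U1)%VS by apply: addvSl.
  have Uw2 : w2 \notin U by apply: contra U1w2; apply: subvP.
  have dU2 : \dim U2 = j.+1 by rewrite dim_add_line ?dU.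
  have sU2 : (U <= U2)%VS by apply: addvSl.
  have eU : (U1 :&: U2)%VS = U.
    apply/esym/eq_dim_sub; first by rewrite subv_cap sU1.
    apply/eqP; rewrite eqn_leq dimvS ?subv_cap ?sU1 //= dU -ltnS -dU1.
    rewrite ltn_neqAle dimvS ?capvSl // andbT; apply: contra U1w2 => /eqP d.
    have w2U2 : w2 \in U2 by rewrite (subvP (addvSr _ _)) ?memv_line.
    have <- // : U2 = U1.
    apply/esym/eq_dim_sub; last by rewrite dU1.
    by rewrite -(eq_dim_sub (capvSl _ _) d) capvSr.
  have scV V : \dim V = j.+1 -> (U <= V)%VS -> (center g (center f U) <= V)%VS.
    by move=> dV sUV; rewrite -[V](level_isoK fg (level0 dV)) scc ?dimf ?sc.
  by rewrite -[X in (_ <= X)%VS]eU subv_cap !scV.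
rewrite /descend dU eqxx dW nj; exact: (center_star fg j_lt dU).2.
Qed.

Lemma descend_iso j f g : level_iso j.+1 f g -> (j.+2 < \dim {: vT})%N ->
  level_iso j (descend j f) (descend j g).
Proof.
by move=> fg j_lt; split; apply: descend_embedding => //; apply: level_iso_sym.
Qed.

End Levels.

(** * Images of subspaces under semilinear maps *)

Section SemilinearImage.

Variables (F : finFieldType) (n : nat).
Implicit Types (s t : {perm 'rV[F]_n}) (U W X : {vspace 'rV[F]_n}).

Lemma GammaL_morph s : s \in GammaL F n -> exists2 tau : {perm F},
  tau \in field_aut F &
  [/\ s 0 = 0, {morph s : u v / u + v} & forall c v, s (c *: v) = tau c *: s v].
Proof.
case/GammaLP=> tau tauA /Defs.semilinearP sl; exists tau => //.
have /field_autP[tau1 tauD _] := tauA.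
have tau0 : tau 0 = 0 by apply: (addrI (tau 0)); rewrite -tauD !addr0.
have s0 : s 0 = 0 by have := sl 0 0 0 0; rewrite tau0 !scale0r !addr0.
split=> // [u v|c v]; first by have := sl 1 1 u v; rewrite tau1 !scale1r.
by have := sl c 0 v 0; rewrite tau0 !scale0r !addr0.
Qed.

(** For [s] semilinear this is the image of [U] as a set, by [mem_simgV]. *)
Definition simg s U : {vspace 'rV[F]_n} := <<[seq s v | v <- vbasis U]>>%VS.

Lemma GammaL_span s (X : seq 'rV[F]_n) v : s \in GammaL F n -> v \in <<X>>%VS ->
  s v \in <<[seq s u | u <- X]>>%VS.
Proof.
move=> /GammaL_morph[tau _ [s0 sD sZ]].
elim: X v => [|x X IH] v /=.
  by rewrite span_nil memv0 => /eqP->; rewrite s0 mem0v.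
rewrite !span_cons => /memv_addP[_ /vlineP[c ->] [y Xy ->]].
by rewrite sD sZ memv_add ?memvZ ?memv_line ?IH.
Qed.

Lemma mem_simg s U v : s \in GammaL F n -> (s v \in simg s U) = (v \in U).
Proof.
move=> sG; have h v' : v' \in U -> s v' \in simg s U.
  by move=> Uv; apply: GammaL_span; rewrite ?(span_basis (vbasisP U)).
apply/idP/idP=> [/(GammaL_span (groupVr sG))|]; last exact: h.
rewrite permK -map_comp (eq_map (g := id)) ?map_id.
  by rewrite (span_basis (vbasisP U)).
by move=> x /=; rewrite permK.
Qed.

Lemma mem_simgV s U v : s \in GammaL F n -> (v \in simg s U) = (s^-1%g v \in U).
Proof. by move=> sG; rewrite -{1}[v](permKV s) mem_simg. Qed.

Lemma simgM s t U : s \in GammaL F n -> t \in GammaL F n ->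
  simg (s * t) U = simg t (simg s U).
Proof.
move=> sG tG; apply/vspaceP=> v.
by rewrite !mem_simgV ?groupM // invMg permM.
Qed.

Lemma simg1 U : simg 1 U = U.
Proof. by apply/vspaceP=> v; rewrite mem_simgV ?group1 // invg1 perm1. Qed.

Lemma simgK s : s \in GammaL F n -> cancel (simg s) (simg s^-1).
Proof. by move=> sG U; rewrite -simgM ?groupV // mulgV simg1. Qed.

Lemma dim_simg s U : s \in GammaL F n -> \dim (simg s U) = \dim U.
Proof.
have le t W : (\dim (simg t W) <= \dim W)%N.
  by rewrite (leq_trans (dim_span _)) // size_map size_tuple.
move=> sG; apply/eqP; rewrite eqn_leq le /=.
by rewrite -{1}[U](simgK sG) le.
Qed.

Lemma simgS s U W : s \in GammaL F n -> (simg s U <= simg s W)%VS = (U <= W)%VS.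
Proof.
move=> sG; apply/subvP/subvP=> sUW v; last by rewrite !mem_simgV //; apply: sUW.
by move=> Uv; rewrite -(mem_simg _ _ sG) sUW ?mem_simg.
Qed.

Lemma simg_line s v : s \in GammaL F n -> simg s <[v]> = <[s v]>%VS.
Proof.
move=> sG; have [tau _ [s0 _ _]] := GammaL_morph sG.
apply/esym/eq_dim_sub; first by rewrite -memvE mem_simg ?memv_line.
by rewrite dim_simg // !dim_vline -{1}s0 (inj_eq perm_inj).
Qed.

Lemma dim_rVf : \dim {: 'rV[F]_n} = n.
Proof. by rewrite dimvf dim_matrix; apply: mul1n. Qed.

Lemma exists_dim m : (m <= n)%N -> exists U, \dim U = m.
Proof.
move=> le_mn; have [||U [_ _ dU]] := @exists_between _ _ 0%VS {: 'rV[F]_n} m.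
- exact: sub0v.
- by rewrite dimv0 dim_rVf.
by exists U.
Qed.

(* A subspace of dimension [j.+1] is covered by its subspaces of dimension [j]
   as soon as [0 < j]. *)
Lemma simg_lift j f g s : level_iso j f g -> s \in GammaL F n ->
    (0 < j)%N -> (forall U, \dim U = j -> f U = simg s U) ->
  forall U, level j U -> f U = simg s U.
Proof.
move=> fg sG j_gt0 fs U /orP[/eqP|/eqP dU]; first exact: fs.
apply/esym/eq_dim_sub; last by rewrite dim_simg // (level_iso_dim fg) ?level1.
apply/subvP=> v; rewrite mem_simgV // => Uv.
have [||A [sA sAU dA]] := @exists_between _ _ <[s^-1%g v]>%VS U j.
- by rewrite -memvE.
- by rewrite dim_vline dU leqnSn andbT (leq_trans (leq_b1 _)).
have: (simg s A <= f U)%VS by rewrite -fs // (level_iso_sub fg).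
move/subvP; apply; rewrite mem_simgV //; move/subvP: sA; apply; exact: memv_line.
Qed.

(** A vector [p v] picked in the image of each point satisfies the hypotheses of
    [fundamental_theorem]: two distinct image points lie in the image of the plane they come from,
    and therefore span it. *)
Lemma level1_iso_induced f g : (2 < n)%N -> level_iso 1 f g ->
  exists2 s, s \in GammaL F n & forall U, level 1 U -> f U = simg s U.
Proof.
move=> n3 fg; pose p (v : 'rV[F]_n) := vpick (f <[v]>%VS).
have dimL (v : 'rV[F]_n) : v != 0 -> \dim <[v]>%VS = 1%N by rewrite dim_vline => ->.
have dimfL v : v != 0 -> \dim (f <[v]>%VS) = 1%N.
  by move=> v0; rewrite (level_iso_dim fg) ?level0 ?dimL.
have p0 v : v != 0 -> p v != 0.
  by move=> v0; rewrite vpick0 -dimv_eq0 dimfL.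
have pE v : v != 0 -> <[p v]>%VS = f <[v]>%VS.
  move=> v0; apply: eq_dim_sub; first by rewrite -memvE memv_pick.
  by rewrite dimL ?p0 ?dimfL.
have pP u v w : u != 0 -> v != 0 -> w != 0 ->
    (p w \in (<[p u]> + <[p v]>)%VS) = (w \in (<[u]> + <[v]>)%VS).
  move=> u0 v0 w0; rewrite !memvE !pE //.
  have [lu lv lw] : [/\ level 1 <[u]>%VS, level 1 <[v]>%VS & level 1 <[w]>%VS].
    by split; apply: level0; apply: dimL.
  (* When [u] and [v] span the same point, there is no plane and the claim is injectivity on
     points. *)
  have [uv|uv] := eqVneq <[u]>%VS <[v]>%VS.
    rewrite uv !addvv; apply/idP/idP => /eq_dim_sub.
      rewrite !dimfL // => /(_ erefl)/eqP.
      by rewrite (level_iso_inj fg) // => /eqP->; apply: subvv.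
    by rewrite !dimL // => /(_ erefl)->; apply: subvv.
  have dX : \dim (<[u]> + <[v]>) = 2%N.
    rewrite dim_add_line ?dimL //; apply: contraNN uv => uv.
    by rewrite (vline_eq _ uv).
  have [-> _] : (f <[u]>%VS + f <[v]>%VS)%VS = f (<[u]> + <[v]>)%VS /\
      \dim (f <[u]>%VS :&: f <[v]>%VS) = 0%N.
    apply: hyperplanes_add_cap; rewrite ?dimfL //.
    - by rewrite (level_iso_dim fg) ?level1.
    - by rewrite (level_iso_inj fg).
    - by rewrite (level_iso_sub fg) ?dimL ?addvSl.
    - by rewrite (level_iso_sub fg) ?dimL ?addvSr.
  by rewrite (level_iso_sub fg) ?dimL.
have [|tau [h [[tau1 tauD tauM] hlin hp]]] := fundamental_theorem p0 pP.
  by rewrite dim_rVf.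
have tau0 : tau 0 = 0 by apply: (addrI (tau 0)); rewrite -tauD !addr0.
have tau_inj : injective tau.
  move=> a b /eqP; rewrite -subr_eq0 => e; apply/eqP; rewrite -subr_eq0.
  have tN c : - tau c = tau (- c).
    by apply: (addrI (tau c)); rewrite -tauD !subrr tau0.
  rewrite tN -tauD in e; apply: contraTT e => ab.
  apply: contra_eq_neq tau1 => e.
  by rewrite -{1}(mulfV ab) tauM e mul0r eq_sym oner_neq0.
have h_inj : injective h.
  move=> u v huv; apply/eqP; rewrite -subr_eq0; apply: contraT => uv.
  have huv0 : h (u - v) = 0.
    have -> : u - v = 1 *: u + (-1) *: v by rewrite scale1r scaleN1r.
    rewrite hlin huv -scalerDl -tauD.
    by rewrite subrr tau0 scale0r.
  by have := dimL _ (p0 _ uv); rewrite -hp // huv0 dim_vline eqxx.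
(* Finiteness turns the injective [h] and [tau] into permutations. *)
pose s := perm h_inj; have sG : s \in GammaL F n.
  apply/GammaLP; exists (perm tau_inj).
    by apply/field_autP; split=> [|a b|a b]; rewrite !permE.
  by apply/Defs.semilinearP=> c1 c2 v1 v2; rewrite !permE.
exists s => //; apply: (simg_lift fg sG) => // U dU.
have U0 : vpick U != 0 by rewrite vpick0 -dimv_eq0 dU.
have <-: <[vpick U]>%VS = U.
  by apply: eq_dim_sub; rewrite ?dimL ?dU // -memvE memv_pick.
by rewrite simg_line // permE hp // pE.
Qed.

(** Induction on [j] from 1. The [s] obtained for the descended map agrees with [f] on the lower
    level, where [descend] keeps [f], and [simg_lift] carries the agreement to the upper level. *)
Theorem level_iso_induced j f g : (0 < j)%N -> (j.+1 < n)%N -> (2 < n)%N ->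
    level_iso j f g ->
  exists2 s, s \in GammaL F n & forall U, level j U -> f U = simg s U.
Proof.
move=> + + n3; elim: j f g => // -[_|j IH] f g _ j_lt fg.
  exact: level1_iso_induced fg.
have [|||s sG sf] := IH (descend j.+1 f) (descend j.+1 g) => //.
- exact: ltnW.
- by apply: descend_iso => //; rewrite dim_rVf.
exists s => //; apply: (simg_lift fg sG) => // U dU.
by rewrite -sf ?level1 // /descend dU gtn_eqF.
Qed.

End SemilinearImage.

(** * The action of the semilinear group on vertices *)

Section VertexAction.

Variables (F : finFieldType) (n k : nat).
Local Notation vertex := (S_vertex F n k).
Implicit Types (s t : {perm 'rV[F]_n}) (U W : {vspace 'rV[F]_n}) (v w : vertex).

(* [val] with its instances hidden: these repeat the whole vertex predicate. *)
Definition sp v : {vspace 'rV[F]_n} := val v.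
Arguments sp : simpl never.

Lemma spP v : level k (sp v).
Proof. exact: valP. Qed.

Lemma sp_inj : injective sp.
Proof. exact: val_inj. Qed.

Definition mkv U (lU : level k U) : vertex := Sub U lU.
Arguments mkv : simpl never.

Lemma mkvK U (lU : level k U) : sp (mkv lU) = U.
Proof. exact: SubK. Qed.

Lemma S_adjE v w : S_adj v w = (v != w) && ((sp v <= sp w)%VS || (sp w <= sp v)%VS).
Proof. by []. Qed.

(** Both dimensions are [k] or [k.+1], so a proper inclusion between vertices raises the dimension
    by exactly 1. *)
Lemma adjP v w : reflect
  ((sp v <= sp w)%VS /\ \dim (sp w) = (\dim (sp v)).+1 \/
   (sp w <= sp v)%VS /\ \dim (sp v) = (\dim (sp w)).+1) (S_adj v w).
Proof.
rewrite S_adjE; have eqv : (sp v <= sp w)%VS -> \dim (sp v) = \dim (sp w) -> v = w.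
  by move=> s d; apply/sp_inj/eq_dim_sub.
have eqw : (sp w <= sp v)%VS -> \dim (sp v) = \dim (sp w) -> v = w.
  by move=> s d; apply/esym/sp_inj/eq_dim_sub.
have := spP w; have := spP v; rewrite /level => lv lw.
apply: (iffP andP) => [[nvw /orP[s|s]]|[[s d]|[s d]]].
- left; split=> //; have := dimvS s; have := contra_neq (eqv s) nvw.
  by move: lv lw => /orP[]/eqP-> /orP[]/eqP->; lia.
- right; split=> //; have := dimvS s; have := contra_neq (eqw s) nvw.
  by move: lv lw => /orP[]/eqP-> /orP[]/eqP->; lia.
- by split; [apply: contra_eq_neq d => -> | rewrite s]; lia.
- by split; [apply: contra_eq_neq d => -> | rewrite s orbT]; lia.
Qed.

(** The default 1 makes this total on permutations; only its values on [GammaL F n], the domain of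
    the morphism, matter. *)
Definition vperm s : {perm vertex} :=
  odflt 1%g [pick t : {perm vertex} | [forall v, sp (t v) == simg s (sp v)]].

Lemma vpermE s v : s \in GammaL F n -> sp (vperm s v) = simg s (sp v).
Proof.
move=> sG; rewrite /vperm; case: pickP => [t /forallP/(_ v)/eqP //|].
have vs (u : vertex) : (\dim (simg s (sp u)) == k) || (\dim (simg s (sp u)) == k.+1).
  by rewrite dim_simg //; apply: spP.
have f_inj : injective (fun u => mkv (vs u)).
  by move=> u w /(congr1 sp); rewrite !mkvK => /(can_inj (simgK sG))/sp_inj.
move=> /(_ (perm f_inj))/negP[]; apply/forallP=> u.
by rewrite permE mkvK.
Qed.

Lemma vpermM : {in GammaL F n &, {morph vperm : s t / (s * t)%g}}.
Proof.
move=> s t sG tG; apply/permP=> v; apply: sp_inj.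
by rewrite permM !vpermE ?groupM // simgM.
Qed.

Canonical vperm_morphism := Morphism vpermM.

Lemma simg_scalar s U : s \in scalar_maps F n -> simg s U = U.
Proof.
move=> sS; have sG := subsetP (normal_sub (scalar_maps_normal F n)) _ sS.
have [c c0 def_s] := scalar_mapsP _ sS.
apply/vspaceP=> v; rewrite mem_simgV //.
by rewrite -{2}[v](permKV s) def_s memvZ_eq.
Qed.

(** A map fixing all subspaces of dimension [k] fixes every line, hence multiplies each vector by a
    scalar; for independent [x] and [y] the image of [x + y] shows that the scalars are equal. *)
Lemma ker_vperm : (0 < k)%N -> (k.+1 < n)%N ->
  'ker vperm_morphism = scalar_maps F n.
Proof.
move=> k0 kn; apply/setP=> s; apply/idP/idP=> [sK|sS]; last first.
  have sG := subsetP (normal_sub (scalar_maps_normal F n)) _ sS.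
  apply/(kerP _ sG)/permP=> v; apply: sp_inj.
  by rewrite perm1 [LHS]vpermE // simg_scalar.
have sG : s \in GammaL F n := dom_ker sK.
have fixU U : \dim U = k -> simg s U = U.
  move=> dU; have := mker sK => /permP/(_ (mkv (level0 dU)))/(congr1 sp).
  by rewrite perm1 [LHS]vpermE // mkvK.
have [tau _ [s0 sD sZ]] := GammaL_morph sG.
have s_neq0 x : x != 0 -> s x != 0 by rewrite -{2}s0 (inj_eq perm_inj).
have line x : s x \in <[x]>%VS.
  have [->|x0] := eqVneq x 0; first by rewrite s0 mem0v.
  (* [B] is a hyperplane through [x] avoiding [s x]. A subspace of [B] of dimension [k] through [x]
     is fixed by [s], hence contains [s x]: a contradiction. *)
  apply: contraT => nsx; pose L := (<[x]> + <[s x]>)%VS; pose B := (<[x]> + L^C)%VS.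
  have nB : s x \notin B.
    apply: contra nsx => /memv_addP[_ /vlineP[c ->] [d Cd def_sx]].
    rewrite def_sx memvD ?memvZ ?memv_line //.
    suff ->: d = 0 by apply: mem0v.
    apply/eqP; rewrite -memv0 -(capv_compl L) memv_cap Cd andbT.
    have ->: d = s x - c *: x by rewrite def_sx addrC addKr.
    rewrite memvB //; first by rewrite memvE addvSr.
    by rewrite memvZ // memvE addvSl.
  have dB : (\dim B).+1 = n.
    rewrite -(dim_add_line nB) -[RHS](dim_rVf F); congr (\dim _).
    by rewrite /B -addvA [(L^C + _)%VS]addvC addvA addv_complf.
  have [||U [sU sUB dU]] := @exists_between _ _ <[x]>%VS B k.
  - exact: addvSl.
  - by rewrite dim_vline x0 k0 /=; lia.
  case/negP: nB; apply: (subvP sUB); rewrite -(fixU U dU) mem_simg //.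
have same x y a b : x != 0 -> y \notin <[x]>%VS ->
    s x = a *: x -> s y = b *: y -> a = b.
  move=> x0 xy sx sy; have /vlineP[c sxy] := line (x + y).
  have: a *: x + b *: y = c *: x + c *: y by rewrite -sx -sy -sD sxy scalerDr.
  by case/(indep2_eq x0 xy) => -> ->.
have n3 : (2 < \dim {: 'rV[F]_n})%N by rewrite dim_rVf; lia.
have [x] := exists_notin_add2 0 0 n3; rewrite addvv => /notin_line_neq0 x0.
have /vlineP[c sx] := line x; apply/scalar_mapsP; exists c => [|y].
  by apply: contra_neq (s_neq0 x x0) => c0; rewrite sx c0 scale0r.
have [->|y0] := eqVneq y 0; first by rewrite s0 scaler0.
have /vlineP[d sy] := line y; rewrite sy; congr (_ *: y); apply/esym.
have [xy|xy] := boolP (y \in <[x]>%VS); last exact: same sx sy.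
(* For proportional [x] and [y], both scalars are compared with that of a vector [z] off their
   line. *)
have [z] := exists_notin_add2 x x n3; rewrite addvv => xz.
have /vlineP[b sz] := line z; rewrite (same x z c b) //.
by apply/esym/(same y z) => //; rewrite (vline_eq y0 xy).
Qed.

(* Junk value: [vertex_ext phi U = U] outside the two levels of the graph. *)
Definition vertex_ext (phi : {perm vertex}) U : {vspace 'rV[F]_n} :=
  if insub U is Some v then sp (phi v) else U.

Lemma vertex_extE (phi : {perm vertex}) v : vertex_ext phi (sp v) = sp (phi v).
Proof. by rewrite /vertex_ext -/(sp v) [insub _]valK. Qed.

Lemma vertex_ext_embedding (phi : {perm vertex}) :
    phi \in graph_aut (@S_adj F n k) ->
    (forall v, \dim (sp (phi v)) = \dim (sp v)) ->
  level_embedding k (vertex_ext phi) (vertex_ext phi^-1).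
Proof.
move=> /graph_autP aut dphi; split=> [U lU|U lU|U W dU dW sUW].
- by rewrite -[U](mkvK lU) vertex_extE.
- by rewrite -[U](mkvK lU) !vertex_extE permK.
pose u : vertex := mkv (level0 dU); pose w : vertex := mkv (level1 dW).
have [eu ew] : U = sp u /\ W = sp w by rewrite !mkvK.
have /adjP : S_adj (phi u) (phi w).
  by rewrite aut; apply/adjP; left; rewrite -eu -ew dU dW.
rewrite eu ew !vertex_extE !dphi -eu -ew dU dW.
by case=> -[] // _ /eqP; rewrite ltn_eqF.
Qed.

Lemma part_preserving_induced (phi : {perm vertex}) :
    (0 < k)%N -> (k.+1 < n)%N -> phi \in graph_aut (@S_adj F n k) ->
    (forall v, \dim (sp (phi v)) = \dim (sp v)) ->
  exists2 s, s \in GammaL F n & phi = vperm s.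
Proof.
move=> k0 kn aut dphi; have fg : level_iso k (vertex_ext phi) (vertex_ext phi^-1).
  split; first exact: vertex_ext_embedding.
  rewrite -{2}[phi]invgK; apply: vertex_ext_embedding; first by rewrite groupV.
  by move=> v; rewrite -{2}[v](permKV phi) dphi.
have [|s sG sE] := level_iso_induced k0 kn _ fg; first by lia.
exists s => //; apply/permP=> v; apply: sp_inj.
by rewrite vpermE // -sE ?spP // vertex_extE.
Qed.

Lemma im_vperm : (0 < k)%N -> (k.+1 < n)%N ->
  vperm_morphism @* GammaL F n = [set phi in graph_aut (@S_adj F n k) |
    [forall v, \dim (sp (phi v)) == \dim (sp v)]].
Proof.
move=> k0 kn; apply/setP=> phi; rewrite inE; apply/idP/idP.
  case/morphimP=> s _ sG ->; apply/andP; split; last first.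
    by apply/forallP=> v; rewrite [sp _]vpermE // dim_simg.
  apply/graph_autP=> v w; rewrite !S_adjE (inj_eq perm_inj).
  by rewrite !vpermE // !simgS.
case/andP=> aut /forallP dphi; have [|s sG ->] := part_preserving_induced k0 kn aut.
  by move=> v; apply/eqP.
by apply/morphimP; exists s.
Qed.

End VertexAction.

(** * Paths in the graph and the exchange of levels *)

Section Paths.

Variables (F : finFieldType) (n k : nat).
Local Notation vertex := (S_vertex F n k).
Local Notation adj := (@S_adj F n k).
Implicit Types (U W A : {vspace 'rV[F]_n}) (v w : vertex) (phi : {perm vertex}).

(* [2 * \dim (A :&: v) - \dim v] drops by at most 1 along an edge. *)
Lemma path_dim_cap A v p : path adj v p ->
  (2 * \dim (A :&: sp v) + \dim (sp (last v p))
    <= 2 * \dim (A :&: sp (last v p)) + size p + \dim (sp v))%N.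
Proof.
elim: p v => [|w p IH] v; first by move=> _; rewrite addn0.
rewrite last_cons; change (size (w :: p)) with (size p).+1.
case/andP=> /adjP vw /IH; case: vw => -[s d].
  by have := dimvS (capvS (subvv A) s); move: d; lia.
have : (\dim (A :&: sp v) <= (\dim (A :&: sp w)).+1)%N.
  have := dimv_sum_cap (A :&: sp v)%VS (sp w).
  have ->: ((A :&: sp v) :&: sp w)%VS = (A :&: sp w)%VS.
    by rewrite -capvA (capv_idPr s).
  have : (A :&: sp v + sp w <= sp v)%VS by rewrite subv_add capvSr.
  move/dimvS; rewrite d; lia.
move: d; lia.
Qed.

(** For [x] in [w] outside [v], two edges lead from [v] through [v + <[x]>] to some [u] containing
    [v :&: w] and [x], so the intersection with [w] gains a dimension. *)
Lemma connect_small m v w : (0 < k)%N -> \dim (sp v) = k -> \dim (sp w) = k ->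
    (k <= \dim (sp v :&: sp w) + m)%N ->
  exists p, [/\ path adj v p, last v p = w & (size p <= 2 * m)%N].
Proof.
move=> k0; elim: m v => [|m IH] v dv dw dvw.
  exists [::]; split=> //=; apply: sp_inj; rewrite addn0 in dvw.
  have e1 : (sp v :&: sp w)%VS = sp v.
    apply: eq_dim_sub; first exact: capvSl.
    by apply/eqP; rewrite eqn_leq dimvS ?capvSl //= dv.
  by apply: eq_dim_sub; rewrite ?dv // -e1 capvSr.
have [swv|/subvPn[x wx vx]] := boolP (sp w <= sp v)%VS.
  exists [::]; split=> //=; apply: sp_inj.
  by apply/esym/eq_dim_sub; rewrite ?dv.
have dX : \dim (sp v + <[x]>) = k.+1 by rewrite dim_add_line ?dv.
pose X : vertex := mkv (level1 dX).
pose B := (sp v :&: sp w + <[x]>)%VS.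
have dB : \dim B = (\dim (sp v :&: sp w)).+1.
  by rewrite dim_add_line // memv_cap (negPf vx).
have sBw : (B <= sp w)%VS by rewrite subv_add capvSr -memvE.
have [||U [sBU sUX dU]] := @exists_between _ _ B (sp X) k.
- by rewrite mkvK addvS ?capvSl.
- by rewrite mkvK dX leqnSn andbT -dw dimvS.
pose u : vertex := mkv (level0 dU).
have [|||p [pp lp szp]] := IH u; rewrite ?mkvK //.
  have : (B <= U :&: sp w)%VS by rewrite subv_cap sBU.
  by move/dimvS; rewrite dB; move: dvw; lia.
exists [:: X, u & p]; split=> //=; last by rewrite mulnS add2n !ltnS.
rewrite pp andbT; apply/andP; split; apply/adjP.
  by left; rewrite mkvK addvSl dX dv.
by right; rewrite [sp u]mkvK sUX mkvK dX dU.
Qed.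

(** Edges join different levels, so whether [phi] keeps the level of a vertex is the same at both
    ends of an edge, hence everywhere by connectedness. *)
Lemma aut_parts phi : (0 < k)%N -> (k < n)%N -> phi \in graph_aut adj ->
  (forall v, \dim (sp (phi v)) = \dim (sp v)) \/
  (forall v, \dim (sp (phi v)) != \dim (sp v)).
Proof.
move=> k0 kn /graph_autP aut.
pose P v := \dim (sp (phi v)) == \dim (sp v).
have adjPP v w : adj v w -> P v = P w.
  move=> vw; have := vw; rewrite -aut => /adjP fvw; move/adjP: vw => vw.
  have := spP (phi v); have := spP (phi w).
  have := spP v; have := spP w; rewrite /level /P.
  by case: fvw => -[_]; case: vw => -[_]; lia.
have pathP' v p : path adj v p -> P v = P (last v p).
  by elim: p v => [//|w p IH] v /= /andP[/adjPP-> /IH].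
have [U0 dU0] := exists_dim F (ltnW kn).
pose b : vertex := mkv (level0 dU0).
have Pk v : \dim (sp v) = k -> P v = P b.
  move=> dv; have [||p [pp lp _]] := @connect_small k v b k0 dv.
  - by rewrite mkvK.
  - exact: leq_addl.
  by rewrite (pathP' _ _ pp) lp.
have PE v : P v = P b.
  have /orP[/eqP/Pk//|/eqP dv] := spP v.
  have [||U [_ sU dU]] := @exists_between _ _ 0%VS (sp v) k.
  - exact: sub0v.
  - by rewrite dimv0 dv leqnSn.
  pose u : vertex := mkv (level0 dU).
  rewrite -(@adjPP u v) ?Pk ?mkvK //.
  by apply/adjP; left; rewrite mkvK sU dv dU.
case Pb: (P b); [left|right] => v; have := PE v; rewrite Pb.
  by move/eqP.
by move/negbT.
Qed.

Lemma aut_preserves_parts phi : (0 < k)%N -> (2 * k + 2 <= n)%N ->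
  phi \in graph_aut adj -> forall v, \dim (sp (phi v)) = \dim (sp v).
Proof.
move=> k0 kn aut; have /graph_autP aut' := aut.
have [|//|sw] := aut_parts k0 _ aut; first by lia.
have [W1 dW1] : exists U : {vspace 'rV[F]_n}, \dim U = k.+1.
  by apply: exists_dim; lia.
(* A complement of [W1] has dimension [n - k.+1], at least [k.+1] since [2 * k + 2 <= n]. *)
have [||W2 [_ sW2 dW2]] := @exists_between _ _ 0%VS W1^C k.+1.
- exact: sub0v.
- by rewrite dimv0 dimv_compl dim_rVf; lia.
pose w1 : vertex := mkv (level1 dW1); pose w2 : vertex := mkv (level1 dW2).
have dimV w : \dim (sp w) = k.+1 -> \dim (sp (phi^-1%g w)) = k.
  move=> dw; have := sw (phi^-1%g w); rewrite permKV dw eq_sym.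
  by have /orP[/eqP//|->] := spP (phi^-1%g w).
have [|||p [pp lp szp]] := @connect_small k (phi^-1%g w1) (phi^-1%g w2) k0.
- by rewrite dimV ?mkvK.
- by rewrite dimV ?mkvK.
- exact: leq_addl.
have pp' : path adj w1 (map phi p).
  by rewrite -[w1](permKV phi); apply: homo_path pp => u w; rewrite aut'.
have last_p : last w1 (map phi p) = w2.
  by rewrite -{1}[w1](permKV phi) last_map lp permKV.
(* As [W1] and [W2] meet trivially, this bounds the length of the path below by [2 * k + 2], against
   the upper bound [2 * k]. *)
have := path_dim_cap W1 pp'; rewrite last_p size_map !mkvK capvv dW1 dW2.
have ->: (W1 :&: W2)%VS = 0%VS.
  by apply/eqP; rewrite -subv0 -(capv_compl W1) capvS.
by rewrite dimv0; lia.
Qed.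

End Paths.

(** * Orthogonal complements for the standard bilinear form *)

Section Orthogonal.

Variables (F : finFieldType) (n : nat).
Implicit Types (U W : {vspace 'rV[F]_n}).

Definition orth U : {vspace 'rV[F]_n} :=
  lker (linfun (mulmxr (\matrix_(i < \dim U) (vbasis U)`_i)^T)).

Lemma mem_orth U v : reflect {in U, forall u, v *m u^T = 0} (v \in orth U).
Proof.
rewrite memv_ker lfunE /=; apply: (iffP eqP) => [h u Uu|h].
  rewrite (coord_vbasis Uu) !linear_sum big1 //= => i _.
  rewrite linearZ -scalemxAr.
  suff ->: v *m ((vbasis U)`_i)^T = 0 by rewrite scaler0.
  apply/matrixP=> a b; have /matrixP/(_ 0 i) := h.
  rewrite !ord1 !mxE => e; rewrite -[RHS]e.
  by apply: eq_bigr => j _; rewrite !mxE.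
apply/matrixP=> a i; have Ui : (vbasis U)`_i \in U.
  by rewrite vbasis_mem ?mem_nth ?size_tuple.
have /matrixP/(_ 0 0) := h _ Ui; rewrite !ord1 !mxE => e; rewrite -[RHS]e.
by apply: eq_bigr => j _; rewrite !mxE.
Qed.

Lemma orthS U W : (U <= W)%VS -> (orth W <= orth U)%VS.
Proof.
move/subvP=> sUW; apply/subvP=> v /mem_orth h; apply/mem_orth=> u Uu.
exact/h/sUW.
Qed.

(** Rank-nullity: [orth U] is the kernel of a map into a space of dimension [\dim U]. *)
Lemma dim_orth_geq U : (n <= \dim U + \dim (orth U))%N.
Proof.
pose f := linfun (mulmxr (\matrix_(i < \dim U) (vbasis U)`_i)^T
                    : 'rV[F]_n -> 'rV_(\dim U)).
have := limg_ker_dim f fullv; rewrite capfv dim_rVf => def_n.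
rewrite -[X in (X <= _)%N]def_n addnC leq_add2r.
by rewrite (leq_trans (dimvS (subvf _))) // dim_rVf.
Qed.

Lemma orth_full : orth fullv = 0%VS.
Proof.
apply/eqP; rewrite -subv0; apply/subvP=> v /mem_orth h; rewrite memv0.
apply/eqP/rowP=> i; have /matrixP/(_ 0 0) := h (delta_mx 0 i) (memvf _).
by rewrite trmx_delta -colE !mxE.
Qed.

(** [U] and [orth U] may intersect, so [orth U] is compared with [orth U^C] instead: a common vector
    is orthogonal to everything, and the two lower bounds on dimensions already add up to [n]. *)
Lemma dim_orth U : \dim (orth U) = (n - \dim U)%N.
Proof.
have cap0 : (orth U :&: orth U^C)%VS = 0%VS.
  apply/eqP; rewrite -subv0 -orth_full.
  apply/subvP=> v /memv_capP[/mem_orth h1 /mem_orth h2].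
  apply/mem_orth=> u _; have : u \in (U + U^C)%VS by rewrite addv_complf memvf.
  case/memv_addP=> u1 /h1 e1 [u2 /h2 e2 ->].
  by rewrite linearD /= mulmxDr e1 e2 addr0.
have := dimv_disjoint_sum cap0; have := dimvS (subvf (orth U + orth U^C)%VS).
have := dim_orth_geq U; have := dim_orth_geq U^C; rewrite dimv_compl !dim_rVf.
have := dimvS (subvf U); rewrite dim_rVf.
lia.
Qed.

Lemma orthK U : orth (orth U) = U.
Proof.
apply/esym/eq_dim_sub; last first.
  by rewrite !dim_orth subKn // -[X in (_ <= X)%N](dim_rVf F n) dimvS ?subvf.
apply/subvP=> u Uu; apply/mem_orth=> v /mem_orth/(_ u Uu) h.
by rewrite -[LHS]trmxK trmx_mul trmxK h trmx0.
Qed.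

Lemma orth_sub U W : (orth U <= orth W)%VS = (W <= U)%VS.
Proof. by apply/idP/idP=> /orthS //; rewrite !orthK. Qed.

End Orthogonal.

(** * The polarity exchanging the levels when [n = 2 * k + 1] *)

Section Polarity.

Variables (F : finFieldType) (n k : nat).
Hypothesis n_odd : n = (2 * k + 1)%N.
Local Notation vertex := (S_vertex F n k).
Implicit Types (v w : vertex).

Lemma level_orth v : level k (orth (sp v)).
Proof.
rewrite /level dim_orth; have := spP v; rewrite /level.
by case/orP=> /eqP->; apply/orP; [right|left]; apply/eqP; lia.
Qed.

Lemma polarity_inj : injective (fun v => mkv (level_orth v)).
Proof.
by move=> v w /(congr1 (@sp F n k)); rewrite !mkvK => /(can_inj (@orthK F n))/sp_inj.
Qed.

Definition polarity : {perm vertex} := perm polarity_inj.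

Lemma polarityE v : sp (polarity v) = orth (sp v).
Proof. by rewrite permE mkvK. Qed.

Lemma polarityK : (polarity * polarity = 1)%g.
Proof. by apply/permP=> v; apply: sp_inj; rewrite permM perm1 !polarityE orthK. Qed.

Lemma polarity_aut : polarity \in graph_aut (@S_adj F n k).
Proof.
apply/graph_autP=> v w; rewrite !S_adjE (inj_eq perm_inj) !polarityE !orth_sub.
by rewrite orbC.
Qed.

Lemma dim_polarity v : \dim (sp (polarity v)) = (n - \dim (sp v))%N.
Proof. by rewrite polarityE dim_orth. Qed.

End Polarity.

(** * The automorphism group in the two cases *)

Theorem theorem3p15 (F : finFieldType) (n k : nat)
    (hn : (3 <= n)%N) (hk0 : (0 < k)%N) (hk : (2 * k < n)%N) :
  ((n <> 2 * k + 1)%N ->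
     (graph_aut (@S_adj F n k) \isog PGammaL F n)%g) /\
  ((n = 2 * k + 1)%N ->
     isog_sdprod (graph_aut (@S_adj F n k)) (PGammaL F n) (Zp 2)).
Proof.
have kn : (k.+1 < n)%N by lia.
have im_isog : vperm_morphism F n k @* GammaL F n \isog PGammaL F n.
  rewrite isog_sym; have := first_isog (vperm_morphism F n k).
  by rewrite (ker_vperm F hk0 kn).
split=> [n_neq|n_odd].
  suff <-: vperm_morphism F n k @* GammaL F n = graph_aut (@S_adj F n k) by [].
  rewrite im_vperm //; apply/setP=> phi; rewrite inE andbC.
  case aut: (phi \in graph_aut _); last by rewrite andbF.
  rewrite andbT; apply/forallP=> v; apply/eqP.
  by apply: aut_preserves_parts; rewrite ?aut //; lia.
pose N := (vperm_morphism F n k @* GammaL F n)%G.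
have memN phi : reflect (phi \in graph_aut (@S_adj F n k) /\
    forall v, \dim (sp (phi v)) = \dim (sp v)) (phi \in N).
  rewrite /= im_vperm //; apply: (iffP setIdP) => -[aut h]; split=> //.
    by move=> v; apply/eqP/(forallP h).
  by apply/forallP=> v; rewrite h.
pose d := polarity F n_odd.
have daut : d \in graph_aut (@S_adj F n k) := polarity_aut F n_odd.
have dV : d^-1%g = d by apply/eqP; rewrite eq_invg_mul polarityK.
have dim_d v : \dim (sp (d v)) != \dim (sp v).
  by rewrite dim_polarity; apply/eqP; lia.
have [U0 dU0] : exists U : {vspace 'rV[F]_n}, \dim U = k.
  by apply: exists_dim; lia.
pose b : S_vertex F n k := mkv (level0 dU0).
have dN : d \notin N by apply/negP=> /memN[_ /(_ b)/eqP]; rewrite (negPf (dim_d b)).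
have d1 : d != 1%g by apply: contraNneq dN => ->; apply: group1.
have od : #[d]%g = 2%N.
  by apply: nt_prime_order => //; rewrite expgS expg1 polarityK.
exists N, <[d]>%G; split=> //.
  rewrite (isog_cyclic_card _ (cycle_cyclic d)) card_Zp // -orderE od eqxx andbT.
  by apply/cyclicP; exists Zp1; apply: Zp_cycle.
have nNd : <[d]> \subset 'N(N).
  rewrite cycle_subG inE; apply/subsetP=> _ /imsetP[phi /memN[aut h] ->].
  apply/memN; split; first by rewrite groupJ.
  (* Conjugation by [d] complements the dimension twice; with truncated subtraction,
     [n - (n - m) = m] requires [m <= n]. *)
  move=> v; rewrite conjgE !permM dV dim_polarity h dim_polarity.
  have : (\dim (sp v) <= n)%N by rewrite -[X in (_ <= X)%N](dim_rVf F n) dimvS ?subvf.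
  by move=> le; rewrite subKn.
have NId : N :&: <[d]> = 1%g.
  apply/trivgP/subsetP=> x /setIP[Nx]; have /= -> := cycle2g od => /set2P[->|xd].
    exact: set11.
  by rewrite -xd Nx in dN.
rewrite sdprodE //; apply/eqP; rewrite eqEsubset; apply/andP; split.
  rewrite mul_subG ?cycle_subG //; apply/subsetP=> x /memN[] //.
apply/subsetP=> phi aut; have [|h|h] := aut_parts hk0 _ aut; first exact: ltnW.
  rewrite -[phi]mulg1 mem_mulg ?group1 //; apply/memN; split=> //.
(* If [phi] exchanges the levels, then [phi * d] preserves them and [phi = (phi * d) * d]. *)
rewrite -[phi](mulgK d) dV mem_mulg ?cycle_id //; apply/memN.
split=> [|v]; first by rewrite groupM.
rewrite permM dim_polarity.
have := h v; have := spP v; have := spP (phi v); rewrite /level.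
by move=> /orP[]/eqP-> /orP[]/eqP->; rewrite ?eqxx // => _; lia.
Qed.
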